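(* Let $n\in\mathbb{N}$, let $(\kappa,k)\in\mathcal{L}_n$, where $k$ has a power-law singularity at the origin, i.e. $k(t)=t^{p}k_1(t)$ for $t>0$ with $-1<p<0$, $k_1\in C[0,+\infty)$ and $k_1(0)\neq 0$, and let $\kappa\in C_{-1}^{n-1}(0,+\infty)$. Then the general fractional derivative $\mathbb{D}_{(k)}$, defined on the space $C_{-1,(k)}^{(1)}(0,+\infty)$, has the following $n$-dimensional null space: $$\mathrm{Ker}\,\mathbb{D}_{(k)}=\left\{\sum_{i=0}^{n-1}a_i\,\frac{d^{\,n-1-i}\kappa}{dt^{\,n-1-i}}:\ a_0,\dots,a_{n-1}\in\mathbb{R}\right\}.$$
   Context: All functions are real-valued functions of $t>0$. $(f*g)(t)=\int_0^t f(t-\tau)g(\tau)\,d\tau$ is the Laplace convolution, and $h_n(t)=t^{n-1}/(n-1)!$ for $n\in\mathbb{N}=\{1,2,\dots\}$. $C_{-1}(0,+\infty)=\{f:\ f(t)=t^pf_1(t),\ t>0,\ p>-1,\ f_1\in C[0,+\infty)\}$. $C_{-1,0}(0,+\infty)=\{f:\ f(t)=t^pf_1(t),\ t>0,\ -1<p<0,\ f_1\in C[0,+\infty)\}$. For $m\in\mathbb{N}_0$, $C_{-1}^m(0,+\infty)=\{f\in C_{-1}(0,+\infty):\ f^{(m)}\in C_{-1}(0,+\infty)\}$ (derivative taken on $(0,+\infty)$). $\mathcal{L}_n$ is the set of pairs $(\kappa,k)$ with $\kappa\in C_{-1}(0,+\infty)$, $k\in C_{-1,0}(0,+\infty)$ and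 $(\kappa*k)(t)=h_n(t)$ for all $t>0$. The general fractional derivative (Riemann-Liouville type) with kernel $k$ is $(\mathbb{D}_{(k)}f)(t)=\frac{d^n}{dt^n}(k*f)(t)$, $t>0$, considered on its natural domain $C_{-1,(k)}^{(1)}(0,+\infty)=\{f\in C_{-1}(0,+\infty):\ \mathbb{D}_{(k)}f \text{ exists on } (0,+\infty) \text{ and } \mathbb{D}_{(k)}f\in C_{-1}(0,+\infty)\}$. Its null space is $\mathrm{Ker}\,\mathbb{D}_{(k)}=\{f\in C_{-1,(k)}^{(1)}(0,+\infty):\ (\mathbb{D}_{(k)}f)(t)=0,\ t>0\}$. *)

(* Defs.v *)
From HB Require Import structures.
From mathcomp Require Import all_boot all_order all_algebra.
From mathcomp Require Import all_classical all_reals all_analysis.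

Set Implicit Arguments.
Unset Strict Implicit.
Unset Printing Implicit Defensive.

Import Order.TTheory GRing.Theory Num.Theory.
Import numFieldNormedType.Exports.

Local Open Scope classical_set_scope.
Local Open Scope ring_scope.

(* A real function of t > 0 is represented by a total function R -> R whose
   values at t <= 0 are irrelevant: every definition below depends only on the
   values at t > 0, so all the sets of functions are closed under changing
   their elements on ]-oo, 0]. *)

Section Defs.
Context {R : realType}.
Implicit Types (f g k kappa : R -> R) (n m : nat).

(* The set of integration is open, so f and g are only evaluated at positive
   points.  The integral is a Lebesgue integral, since the integrand may be
   singular at both end points. *)
Definition laplace_conv f g : R -> R := fun t =>
  \int[lebesgue_measure]_(tau in `]0, t[) (f (t - tau) * g tau).

(* Intended for 0 < n only. *)
Definition h_fun n : R -> R := fun t => t ^+ n.-1 / (n.-1)`!%:R.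

Definition cont_nneg f : Prop := {within `[0, +oo[, continuous f}.

Definition C_m1 : set (R -> R) := [set f |
  exists p f1, [/\ -1 < p, cont_nneg f1 &
    forall t, 0 < t -> f t = t `^ p * f1 t]].

Definition C_m10 : set (R -> R) := [set f |
  exists p f1, [/\ -1 < p < 0, cont_nneg f1 &
    forall t, 0 < t -> f t = t `^ p * f1 t]].

Definition singular_at0 k : Prop :=
  exists p k1, [/\ -1 < p < 0, cont_nneg k1, k1 0 != 0 &
    forall t, 0 < t -> k t = t `^ p * k1 t].

(* derive1n is total, so the existence of f^(n) on ]0, +oo[ is a separate
   condition. *)
Definition nderivable_pos n f : Prop :=
  forall i, (i < n)%N -> forall t : R, 0 < t -> derivable (derive1n i f) t 1.

Definition Cn_m1 m : set (R -> R) := [set f |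
  [/\ C_m1 f, nderivable_pos m f & C_m1 (derive1n m f)]].

Definition L_class n : set ((R -> R) * (R -> R)) := [set q |
  [/\ C_m1 q.1, C_m10 q.2 &
    forall t, 0 < t -> laplace_conv q.1 q.2 t = h_fun n t]].

Definition GFD n k f : R -> R := derive1n n (laplace_conv k f).

Definition GFD_domain n k : set (R -> R) := [set f |
  [/\ C_m1 f, nderivable_pos n (laplace_conv k f) & C_m1 (GFD n k f)]].

Definition GFD_ker n k : set (R -> R) := [set f |
  GFD_domain n k f /\ forall t, 0 < t -> GFD n k f t = 0].

Definition span_pos n (b : 'I_n -> R -> R) : set (R -> R) := [set f |
  exists a : 'I_n -> R, forall t, 0 < t -> f t = \sum_(i < n) a i * b i t].

Definition free_pos n (b : 'I_n -> R -> R) : Prop :=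
  forall a : 'I_n -> R,
    (forall t, 0 < t -> \sum_(i < n) a i * b i t = 0) -> forall i, a i = 0.

(* V, taken modulo equality on ]0, +oo[, is an n-dimensional vector space. *)
Definition has_dim_pos (V : set (R -> R)) n : Prop :=
  exists b : 'I_n -> R -> R, free_pos b /\ V = span_pos b.

End Defs.

(* Main.v *)
Require Import Defs.
From HB Require Import structures.
From mathcomp Require Import all_boot all_order all_algebra.
From mathcomp Require Import all_classical all_reals all_analysis.
From mathcomp Require Import measurable_realfun ring lra.

Set Implicit Arguments.
Unset Strict Implicit.
Unset Printing Implicit Defensive.

Import Order.TTheory GRing.Theory Num.Theory.
Import numFieldNormedType.Exports.

Local Open Scope classical_set_scope.
Local Open Scope ring_scope.

(** Under the Laplace convolution, [C_m1] is a commutative and associative algebra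
    without unit, in which convolution with the constant 1 is integration from 0
    and hence injective ([conv1_inj]). Below, [f * g] is the convolution, [1] is
    the constant function, which is [h_1], and [u^(j)] is the j-th derivative.

    The derivatives of [kappa] of order below [n] are in the null space because
    [kappa^(j) * k = h_(n-j)] for [j < n] ([conv_derive1n]), and [n] derivatives
    kill [h_1, ..., h_n]. To pass from [g = kappa^(j)] to [g'], write
    [g = c + 1 * g'] with [c = g(0+)]; then [h_(m+1) = g * k = 1 * (c k + g' * k)],
    so that [h_m = c k + g' * k]. When [m > 0], the left-hand side is bounded near
    0 and the convolution is less singular than [k] itself, while [k] behaves like
    [t ^ p] with [p < 0]: thus [c = 0] ([conv_derive1]). The derivatives are
    independent, since a relation between them, convolved with [k], is a relation
    between [h_1, ..., h_n].

    Conversely, if the n-th derivative of [k * f] vanishes, then [k * f] is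
    a linear combination of [h_1, ..., h_n] ([derive1n_pos0P]), that is,
    [k * f = k * g] for some [g] in the span. Convolving with
    [kappa^(n-1)], for which [kappa^(n-1) * k = 1], gives [1 * f = 1 * g],
    and therefore [f = g].

    What this takes from analysis is that [C_m1] is stable under convolution,
    with exact control of the exponent at 0 ([power_cont_conv]), and that
    the convolution is commutative ([convC]) and associative ([conv_swap]). *)

(** * Reflections and dilations of Lebesgue integrals *)

Section ChangeOfVariables.
Context {R : realType}.
Local Notation mu := (@lebesgue_measure R).

Lemma measurable_reflect (t : R) (D : set (measurableTypeR R)) :
  measurable_fun D ((fun x => t - x) : measurableTypeR R -> measurableTypeR R).
Proof. exact: measurable_funB. Qed.

Lemma measurable_dilation (a : R) (D : set (measurableTypeR R)) :
  measurable_fun D ((fun x => a * x) : measurableTypeR R -> measurableTypeR R).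
Proof. exact: measurable_funM. Qed.

(** It is enough to compare the two measures on left-open intervals, which
    reflection turns into right-open ones of the same length. *)
Lemma lebesgue_measure_reflect (t : R) (A : set R) : measurable A ->
  pushforward mu ((fun x => t - x) : measurableTypeR R -> measurableTypeR R) A
  = mu A.
Proof.
move=> mA; apply/esym.
apply: (@lebesgue_measure_unique R (pushforward mu
  ((fun x => t - x) : measurableTypeR R -> measurableTypeR R))) => //.
  exact: measurable_reflect.
move=> mf _ [[a b]] _ <-.
rewrite [RHS](_ : _ = mu `[t - b, t - a[%classic); last first.
  congr (mu _); apply/seteqP.
  by split => x /=; rewrite !in_itv /= => /andP[h1 h2]; apply/andP; split; lra.
rewrite !lebesgue_measure_itv /= !lte_fin ltrD2l ltrN2.
by case: ifP => // _; rewrite -!EFinB; congr EFin; ring.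
Qed.

Lemma lebesgue_measure_dilation (a : {nonneg R}) (A : set R) :
  0 < a%:num -> measurable A ->
  pushforward (mscale a mu)
    ((fun x => a%:num * x) : measurableTypeR R -> measurableTypeR R) A = mu A.
Proof.
move=> a0 mA; apply/esym.
apply: (@lebesgue_measure_unique R (pushforward (mscale a mu)
  ((fun x => a%:num * x) : measurableTypeR R -> measurableTypeR R))) => //.
  exact: measurable_dilation.
move=> mf _ [[x y]] _ <-.
rewrite [RHS](_ : _ = ((a%:num)%:E *
    mu `]((a%:num)^-1 * x)%R, ((a%:num)^-1 * y)%R]%classic)%E); last first.
  congr (_ * mu _)%E.
  by apply/seteqP; split => z /=; rewrite !in_itv /= ltr_pdivrMl// ler_pdivlMl.
rewrite !lebesgue_measure_itv /= !lte_fin ltr_pM2l ?invr_gt0//.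
case: ifP => _; last by rewrite mule0.
by rewrite -!EFinB -EFinM; congr EFin; field; lra.
Qed.

(** The nonnegative case carries integrability itself across the reflection, in
    [integrable_reflect]. *)
Lemma ge0_integral_reflect (t : R) (D : set R) (f : R -> \bar R) :
  measurable D -> measurable_fun D f -> (forall x, D x -> (0 <= f x)%E) ->
  (\int[mu]_(x in D) f x =
   \int[mu]_(x in (fun x => t - x)%R @^-1` D) f (t - x)%R)%E.
Proof.
move=> mD mf f0.
have mr := @measurable_reflect t setT.
rewrite -(@ge0_integral_pushforward _ _ _ _ R _ mr mu D f)//; last first.
  by move=> x /set_mem; exact: f0.
by apply: eq_measure_integral => A mA AD; exact/esym/lebesgue_measure_reflect.
Qed.

Lemma integrable_reflect (t : R) (D : set R) (f : R -> R) :
  measurable D -> measurable_fun setT f ->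
  mu.-integrable ((fun x => t - x) @^-1` D) (EFin \o (fun x => f (t - x))) ->
  mu.-integrable D (EFin \o f).
Proof.
move=> mD mf /integrableP[_ h]; apply/integrableP; split.
  exact/measurable_EFinP/measurable_funTS.
rewrite (ge0_integral_reflect t)//.
by apply: measurableT_comp => //; exact/measurable_EFinP/measurable_funTS.
Qed.

Lemma Rintegral_reflect (t : R) (D : set R) (f : R -> R) :
  measurable D -> measurable_fun setT f ->
  mu.-integrable ((fun x => t - x) @^-1` D) (EFin \o (fun x => f (t - x))) ->
  \int[mu]_(x in D) f x = \int[mu]_(x in (fun x => t - x) @^-1` D) f (t - x).
Proof.
move=> mD mf h; have mr := @measurable_reflect t setT.
congr fine; rewrite -[RHS](@integral_pushforward _ _ _ _ R _ mr mu D (EFin \o f))//.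
  by apply: eq_measure_integral => A mA AD; exact/esym/lebesgue_measure_reflect.
exact/measurable_EFinP.
Qed.

Lemma ge0_integral_dilation (a : R) (D : set R) (f : R -> \bar R) : 0 < a ->
  measurable D -> measurable_fun D f -> (forall x, D x -> (0 <= f x)%E) ->
  (\int[mu]_(x in D) f x =
   a%:E * \int[mu]_(x in (fun x => a * x)%R @^-1` D) f (a * x)%R)%E.
Proof.
move=> a0 mD mf f0; pose b := NngNum (ltW a0).
have mr := @measurable_dilation a setT.
have mD' : measurable ((fun x => a * x) @^-1` D).
  by rewrite -[X in measurable X]setTI; exact: mr.
have mf' : measurable_fun ((fun x => a * x) @^-1` D) (fun x => f (a * x)).
  apply: (@measurable_comp _ _ _ _ _ _ D f _ (fun x => a * x)) => //.
    by move=> _ [x Dx <-].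
  exact: measurable_dilation.
transitivity (\int[mscale b mu]_(x in (fun x => a * x)%R @^-1` D) f (a * x)%R)%E;
  last by rewrite ge0_integral_mscale// => x; exact: f0.
rewrite -(@ge0_integral_pushforward _ _ _ _ R _ mr (mscale b mu) D f)//; last first.
  by move=> x /set_mem; exact: f0.
by apply: eq_measure_integral => A mA AD; exact/esym/(@lebesgue_measure_dilation b).
Qed.

(** The signed case follows by splitting into positive and
    negative parts; integrability rules out the difference of two infinities. *)
Lemma Rintegral_dilation (a : R) (D : set R) (f : R -> R) : 0 < a ->
  measurable D -> measurable_fun D f ->
  mu.-integrable ((fun x => a * x) @^-1` D) (EFin \o (fun x => f (a * x))) ->
  \int[mu]_(x in D) f x = a * \int[mu]_(x in (fun x => a * x) @^-1` D) f (a * x).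
Proof.
move=> a0 mD mf h.
have mf' : measurable_fun D (EFin \o f) by exact/measurable_EFinP.
have mD' : measurable ((fun x => a * x) @^-1` D).
  by rewrite -[X in measurable X]setTI; exact: (@measurable_dilation a setT).
rewrite /Rintegral [in LHS]integralE.
rewrite (ge0_integral_dilation a0 mD (measurable_funepos mf'))//.
rewrite (ge0_integral_dilation a0 mD (measurable_funeneg mf'))//.
have ip : (\int[mu]_(x in (fun x => a * x)%R @^-1` D)
    (EFin \o f)^\+ (a * x)%R)%E \is a fin_num.
  apply: integrable_fin_num => //.
  rewrite -[X in integrable _ _ X](funepos_comp (EFin \o f) (fun x => a * x)).
  exact: integrable_funepos.
have im : (\int[mu]_(x in (fun x => a * x)%R @^-1` D)
    (EFin \o f)^\- (a * x)%R)%E \is a fin_num.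
  apply: integrable_fin_num => //.
  rewrite -[X in integrable _ _ X](funeneg_comp (EFin \o f) (fun x => a * x)).
  exact: integrable_funeneg.
rewrite -muleBr// ?fin_num_adde_defr// fineM//; last by rewrite fin_numB ip im.
congr (_ * fine _); rewrite [in RHS]integralE.
by rewrite (funepos_comp (EFin \o f) (fun x => a * x))
           (funeneg_comp (EFin \o f) (fun x => a * x)).
Qed.

End ChangeOfVariables.

(** * Integrability of powers and of the Beta integrand *)

Section PowerFunctions.
Context {R : realType}.
Local Notation mu := (@lebesgue_measure R).
Implicit Types p q : R.

Lemma continuous_powR_gt0 p (x : R) : 0 < x ->
  {for x, continuous (fun y => y `^ p)}.
Proof.
move=> x0; apply: differentiable_continuous; apply/derivable1_diffP.
by apply: derivable_powR; rewrite in_itv /= x0.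
Qed.

Lemma powR_le0_anti p (x y : R) : p <= 0 -> 0 < x -> x <= y -> y `^ p <= x `^ p.
Proof.
move=> p0 x0 xy; rewrite -[p]opprK !(powRN _ (- p)) lef_pV2 ?posrE ?powR_gt0//.
  by apply: ge0_ler_powR; rewrite ?oppr_ge0// nnegrE ltW// (lt_le_trans x0).
exact: lt_le_trans xy.
Qed.

(** This bound does not depend on [a], so it survives the
    passage to the limit [a -> 0] in [integrable_powR]. *)
Lemma integral_powR_bound p (a b : R) : -1 < p -> 0 < a -> a < b ->
  (\int[mu]_(x in `[a, b]) (x `^ p)%:E <= ((p + 1)^-1 * b `^ (p + 1))%:E)%E.
Proof.
move=> p1 a0 ab; have q0 : p + 1 != 0 by rewrite gt_eqF//; lra.
pose F x : R := (p + 1)^-1 * x `^ (p + 1).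
have dF (x : R) : 0 < x -> is_derive x 1 F (x `^ p).
  move=> x0; have := is_deriveZ (p + 1)^-1 (is_derive1_powR (p + 1) x0).
  by rewrite /GRing.scale /= mulrA mulVf// mul1r addrK.
have cF (x : R) : 0 < x -> {for x, continuous F}.
  move=> /dF[h _]; exact/differentiable_continuous/derivable1_diffP.
rewrite (@continuous_FTC2 _ _ F)//.
- rewrite -EFinB lee_fin /F lerBlDr lerDl mulr_ge0 ?powR_ge0//.
  by rewrite invr_ge0; lra.
- apply: continuous_in_subspaceT => x /set_mem /=; rewrite in_itv /= => /andP[ax _].
  by apply: continuous_powR_gt0; exact: lt_le_trans ax.
- split.
  + move=> x; rewrite in_itv /= => /andP[ax _].
    by have [] := dF _ (lt_trans a0 ax).
  + exact/cvg_at_right_filter/cF.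
  + by apply/cvg_at_left_filter/cF; exact: lt_trans ab.
- move=> x; rewrite in_itv /= => /andP[ax _].
  by rewrite derive1E; have [_ ->] := dF _ (lt_trans a0 ax).
Qed.

(** The singularity is at the end point 0, where the fundamental
    theorem of calculus is not available; the interval is exhausted by
    compact intervals away from 0, and monotone convergence applies. *)
Lemma integrable_powR p (T : R) : -1 < p -> 0 < T ->
  mu.-integrable `]0, T[ (EFin \o (fun x => x `^ p)).
Proof.
move=> p1 T0; apply: (@integrableS _ _ _ mu `]0, T]) => //.
  by apply: subset_itvl; rewrite bnd_simp.
apply/integrableP; split.
  by apply/measurable_EFinP; apply: measurable_funTS; exact: measurable_powR.
under eq_integral do rewrite /= ger0_norm ?powR_ge0//.
(* n.+2, not n.+1, so that the left end point stays strictly below T *)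
pose F n : set R := `[T / n.+2%:R, T]%classic.
have FT n : 0 < T / n.+2%:R < T.
  by rewrite divr_gt0//= ltr_pdivrMr// ltr_pMr// ltr1n.
have -> : `]0, T]%classic = \bigcup_n F n.
  apply/seteqP; split => x /=; rewrite ?in_itv /=.
    move=> /andP[x0 xT].
    have [n Hn] : exists n : nat, T / x < n%:R.
      by exists (Num.bound (T / x)); rewrite archi_boundP// divr_ge0 ?ltW.
    exists n => //; rewrite /F /= in_itv /= xT andbT.
    rewrite ler_pdivrMr// mulrC -ler_pdivrMr// (le_trans (ltW Hn))// ler_nat.
    by rewrite (leq_trans (leqnSn n)).
  move=> [n _]; rewrite /F /= in_itv /= => /andP[h ->]; rewrite andbT.
  by have /andP[h2 _] := FT n; exact: lt_le_trans h.
have cv : (\int[mu]_(x in F i) (x `^ p)%:E @[i --> \oo] -->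
     \int[mu]_(x in \bigcup_i F i) (x `^ p)%:E)%E.
  apply: ge0_nondecreasing_set_cvg_integral.
  - apply/nondecreasing_seqP => n; rewrite subsetEset => x; rewrite /F /= !in_itv /=.
    move=> /andP[h ->]; rewrite andbT (le_trans _ h)// ler_pM2l// lef_pV2 ?posrE//.
    by rewrite ler_nat.
  - by move=> i; exact: measurable_itv.
  - by move=> i; apply/measurable_EFinP; apply: measurable_funTS; exact: measurable_powR.
  - by move=> i x _; rewrite lee_fin powR_ge0.
rewrite -(cvg_lim _ cv)//.
apply: (@le_lt_trans _ _ ((p + 1)^-1 * T `^ (p + 1))%:E); last by rewrite ltry.
apply: lime_le; first by apply/cvg_ex; eexists; exact: cv.
by apply: nearW => n; have /andP[h1 h2] := FT n; exact: integral_powR_bound.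
Qed.

Lemma measurable_powR_comp p (D : set R) (f : R -> R) :
  measurable_fun D f -> measurable_fun D (fun x => f x `^ p).
Proof. by move=> mf; apply: (measurableT_comp (measurable_powR _)). Qed.

Lemma integrable_powR_reflect p (T : R) : -1 < p -> 0 < T ->
  mu.-integrable `]0, T[ (EFin \o (fun x => (T - x) `^ p)).
Proof.
move=> p1 T0; apply: (@integrable_reflect R T) => //.
  by apply: measurable_powR_comp; exact: measurable_funB.
have -> : (fun x : R => T - x) @^-1` `]0, T[ = `]0, T[%classic.
  by apply/seteqP; split => x /=; rewrite !in_itv /= => /andP[? ?]; apply/andP; split; lra.
apply: eq_integrable (integrable_powR p1 T0) => //.
by move=> x _ /=; congr (_ `^ _)%:E; ring.
Qed.

(** One of [x] and [T - x] is at least [T / 2], and a power with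
    a nonpositive exponent is decreasing, so one factor is always bounded. This
    dominates the Beta integrand by a sum of two one-point singularities. *)
Lemma beta_le p q (T x : R) : p <= 0 -> q <= 0 -> 0 < x -> x < T ->
  (T - x) `^ p * x `^ q <= (T / 2) `^ p * x `^ q + (T / 2) `^ q * (T - x) `^ p.
Proof.
move=> p0 q0 x0 xT.
have T0 : 0 < T / 2 by lra.
have [h|h] := leP x (T / 2).
  rewrite -[leLHS]addr0; apply: lerD; last by rewrite mulr_ge0 ?powR_ge0.
  by rewrite ler_wpM2r ?powR_ge0// powR_le0_anti//; lra.
rewrite -[leLHS]add0r; apply: lerD; first by rewrite mulr_ge0 ?powR_ge0.
by rewrite mulrC ler_wpM2r ?powR_ge0// powR_le0_anti//; lra.
Qed.

Lemma integrable_beta p q (T : R) : -1 < p <= 0 -> -1 < q <= 0 -> 0 < T ->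
  mu.-integrable `]0, T[ (EFin \o (fun x => (T - x) `^ p * x `^ q)).
Proof.
move=> /andP[p1 p0] /andP[q1 q0] T0.
apply: (@le_integrable _ _ _ mu _ _ _
  (EFin \o (fun x => (T / 2) `^ p * x `^ q + (T / 2) `^ q * (T - x) `^ p))) => //.
- apply/measurable_EFinP; apply: measurable_funM.
    by apply: measurable_powR_comp; exact: measurable_funB.
  by apply: measurable_powR_comp; exact: measurable_id.
- move=> x /=; rewrite in_itv /= => /andP[x0 xT].
  rewrite lee_fin !ger0_norm ?addr_ge0 ?mulr_ge0 ?powR_ge0//.
  exact: beta_le.
- apply: (@integrableD _ _ _ mu `]0, T[ _
    (EFin \o (fun x => (T / 2) `^ p * x `^ q))
    (EFin \o (fun x => (T / 2) `^ q * (T - x) `^ p))) => //.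
    exact: (@integrableZl _ _ _ mu `]0, T[ _ ((T / 2) `^ p) _
      (integrable_powR q1 T0)).
  exact: (@integrableZl _ _ _ mu `]0, T[ _ ((T / 2) `^ q) _
    (integrable_powR_reflect p1 T0)).
Qed.

End PowerFunctions.

(** * Continuous functions with a power singularity at the origin *)

Section PowerCont.
Context {R : realType}.
Local Notation mu := (@lebesgue_measure R).
Implicit Types (p q : R) (f g : R -> R).

(** The class behind [C_m1] with the exponent made explicit. Asking the
    regular factor to be continuous on the whole line costs nothing, since
    a continuous function on the half-line extends by its value at 0
    ([cont_nneg_extend]), and spares later arguments the end point. *)
Definition power_cont p f : Prop := exists2 f1 : R -> R,
  continuous f1 & forall t : R, 0 < t -> f t = t `^ p * f1 t.

Lemma cont_nneg_extend f :
  cont_nneg f -> continuous (fun x : R => f (Num.max x 0)).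
Proof.
move=> /subspace_continuousP cf x.
have mx : (Num.max x 0 : R) \in `[0, +oo[ by rewrite in_itv /= andbT le_max lexx orbT.
have cm : (fun y : R => Num.max y 0) @ x --> Num.max x 0.
  have := @continuous_max _ _ (@id R) (cst (0 : R)) x.
  by apply; [exact: cvg_id | exact: cvg_cst].
have cw : Num.max y (0 : R) @[y --> x] --> within `[0, +oo[ (nbhs (Num.max x (0 : R))).
  move=> P wP; have {}wP :
      \forall z \near Num.max x (0 : R), `[0, +oo[%classic z -> P z := wP.
  have := cm _ wP; rewrite !near_simpl; apply: filterS => y /=.
  by apply; rewrite in_itv /= andbT le_max lexx orbT.
exact: cvg_comp cw (cf _ mx).
Qed.

Lemma cont_nneg_powR p : 0 < p -> cont_nneg (fun x : R => x `^ p).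
Proof.
move=> p0; apply/continuous_within_itvcyP; split.
  by move=> x; rewrite in_itv /= andbT => x0; exact: continuous_powR_gt0.
by rewrite powR0 ?gt_eqF//; exact: powR_cvg0.
Qed.

Lemma power_cont_weaken p q f : q <= p -> power_cont p f -> power_cont q f.
Proof.
rewrite le_eqVlt => /predU1P[-> //|qp] [f1 cf1 f1E].
exists (fun x : R => (Num.max x 0) `^ (p - q) * f1 x).
  move=> x; apply: (continuousM _ (cf1 x)).
  by apply: (@cont_nneg_extend (fun y : R => y `^ (p - q)));
    apply: cont_nneg_powR; rewrite subr_gt0.
move=> t t0; rewrite f1E// max_l ?ltW// mulrA -powRD ?(gt_eqF t0) ?implybT//.
by rewrite addrC subrK.
Qed.

Lemma power_cont_eq p f g : (forall t : R, 0 < t -> f t = g t) ->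
  power_cont p f -> power_cont p g.
Proof. by move=> fg [f1 cf1 f1E]; exists f1 => // t t0; rewrite -fg// f1E. Qed.

Lemma power_contD p f g : power_cont p f -> power_cont p g ->
  power_cont p (fun t : R => f t + g t).
Proof.
move=> [f1 cf1 f1E] [g1 cg1 g1E]; exists (fun t => f1 t + g1 t).
  by move=> x; apply: continuousD; [exact: cf1|exact: cg1].
by move=> t t0; rewrite f1E// g1E// mulrDr.
Qed.

Lemma power_contZ p f (c : R) : power_cont p f ->
  power_cont p (fun t : R => c * f t).
Proof.
move=> [f1 cf1 f1E]; exists (fun t => c * f1 t).
  by move=> x; apply: continuousM; [exact: cvg_cst|exact: cf1].
by move=> t t0; rewrite f1E// mulrCA.
Qed.

Lemma power_cont_norm p f : power_cont p f -> power_cont p (fun t : R => `|f t|).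
Proof.
move=> [f1 cf1 f1E]; exists (fun t => `|f1 t|).
  by move=> x; apply: continuous_comp; [exact: cf1|exact: norm_continuous].
by move=> t t0; rewrite f1E// normrM ger0_norm ?powR_ge0.
Qed.

Lemma power_cont_cst (c : R) : power_cont 0 (fun=> c).
Proof.
by exists (fun=> c) => [x|t t0]; [exact: cvg_cst|rewrite powRr0 mul1r].
Qed.

(** A positive exponent can be absorbed into the regular factor, so the
    exponent may be taken nonpositive. The powers involved are then
    decreasing, as the domination of the convolution integrand requires. *)
Lemma C_m1P f : C_m1 f <-> exists2 p : R, -1 < p <= 0 & power_cont p f.
Proof.
split=> [[p [f1 [p1 cf1 f1E]]]|[p /andP[p1 p0] [f1 cf1 f1E]]]; last first.
  by exists p, f1; split => //; exact: continuous_subspaceT.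
have pf : power_cont p f.
  exists (fun x : R => f1 (Num.max x 0)); first exact: cont_nneg_extend.
  by move=> t t0; rewrite f1E// max_l// ltW.
have [p0|p0] := leP p 0; first by exists p => //; rewrite p1.
by exists 0; [rewrite lexx andbT; lra|exact: power_cont_weaken (ltW p0) pf].
Qed.

Lemma C_m1_eq f g : (forall t : R, 0 < t -> f t = g t) -> C_m1 f -> C_m1 g.
Proof.
by move=> fg /C_m1P[p hp pf]; apply/C_m1P; exists p => //; exact: power_cont_eq pf.
Qed.

Lemma C_m1D f g : C_m1 f -> C_m1 g -> C_m1 (fun t => f t + g t).
Proof.
move=> /C_m1P[p /andP[p1 p0] pf] /C_m1P[q /andP[q1 q0] qg].
apply/C_m1P; exists (Num.min p q); first by rewrite lt_min ge_min p1 q1 p0.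
by apply: power_contD; [apply: power_cont_weaken pf|apply: power_cont_weaken qg];
  rewrite ge_min lexx ?orbT.
Qed.

Lemma C_m1Z f (c : R) : C_m1 f -> C_m1 (fun t => c * f t).
Proof. by move=> /C_m1P[p hp pf]; apply/C_m1P; exists p => //; exact: power_contZ. Qed.

Lemma C_m1_cst (c : R) : C_m1 (fun=> c).
Proof.
by apply/C_m1P; exists 0; [rewrite lexx andbT; lra|exact: power_cont_cst].
Qed.

Lemma C_m1_norm f : C_m1 f -> C_m1 (fun t => `|f t|).
Proof.
by move=> /C_m1P[p hp pf]; apply/C_m1P; exists p => //; exact: power_cont_norm.
Qed.

Lemma C_m1_sum n (a : 'I_n -> R) (b : 'I_n -> R -> R) : (forall i, C_m1 (b i)) ->
  C_m1 (fun t => \sum_(i < n) a i * b i t).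
Proof.
elim: n a b => [|n IH] a b hb.
  by apply: C_m1_eq (C_m1_cst 0) => t _; rewrite big_ord0.
apply: (@C_m1_eq (fun t => \sum_(i < n) a (widen_ord (leqnSn n) i) *
    b (widen_ord (leqnSn n) i) t + a ord_max * b ord_max t)).
  by move=> t _; rewrite big_ord_recr.
by apply: C_m1D; [exact: IH|exact: C_m1Z].
Qed.

Lemma C_m1_continuous f t : C_m1 f -> 0 < t -> {for t, continuous f}.
Proof.
move=> [p [f1 [_ cf1 f1E]]] t0.
have cc : {for t, continuous (fun x => x `^ p * f1 x)}.
  apply: continuousM; first exact: continuous_powR_gt0.
  by move/continuous_within_itvcyP : cf1 => [+ _]; apply; rewrite in_itv /= t0.
rewrite /prop_for /continuous_at f1E//.
apply: cvg_trans cc; apply: near_eq_cvg.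
by near=> x; rewrite f1E//; near: x; exact: lt_nbhsr.
Unshelve. end_near. Qed.

(** Extending by 0 to the whole line makes the functions
    measurable everywhere, whatever their values at nonpositive points. *)
Lemma C_m1_measurable f : C_m1 f -> measurable_fun setT (f \_ `]0, +oo[).
Proof.
move=> Cf; apply: (iffLR (measurable_restrictT _ _)) => //.
apply: open_continuous_measurable_fun; first exact: interval_open.
move=> x /set_mem /=; rewrite in_itv /= andbT; exact: C_m1_continuous.
Qed.

Lemma continuous_bounded (f : R -> R) (T : R) : continuous f ->
  exists2 M : R, 0 <= M & forall x : R, -T <= x <= T -> `|f x| <= M.
Proof.
move=> cf; have [T0|T0] := leP 0 T; last first.
  by exists 0 => // x /andP[h1 h2]; exfalso; lra.
have [||c _ Hc] := @EVT_max R (fun x => `|f x|) (-T) T; first lra.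
  apply: continuous_subspaceT => x; apply: continuous_comp; first exact: cf.
  exact: norm_continuous.
by exists `|f c| => // x hx; apply: Hc; rewrite in_itv.
Qed.

Lemma C_m1_integrable f (T : R) : C_m1 f -> 0 < T -> mu.-integrable `]0, T[ (EFin \o f).
Proof.
move=> Cf T0; have /C_m1P[p /andP[p1 p0] [f1 cf1 f1E]] := Cf.
have [M M0 HM] := continuous_bounded T cf1.
apply: (@le_integrable _ _ _ mu _ _ _ (EFin \o (fun x => M * x `^ p))) => //.
- apply/measurable_EFinP; apply: open_continuous_measurable_fun; first exact: interval_open.
  by move=> x /set_mem /=; rewrite in_itv /= => /andP[x0 _]; exact: C_m1_continuous.
- move=> x /=; rewrite in_itv /= => /andP[x0 xT]; rewrite lee_fin f1E// !normrM.
  rewrite mulrC (ger0_norm (powR_ge0 _ _)) (ger0_norm M0).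
  by rewrite ler_wpM2r ?powR_ge0// HM//; apply/andP; split; lra.
- exact: (@integrableZl _ _ _ mu `]0, T[ _ M _ (integrable_powR p1 T0)).
Qed.

End PowerCont.

(** * Stability under the Laplace convolution *)

Section Convolution.
Context {R : realType}.
Local Notation mu := (@lebesgue_measure R).
Implicit Types (p q t : R) (f g h : R -> R).

(** The integrand is dominated by a multiple of the Beta integrand. *)
Lemma conv_integrable f g t : C_m1 f -> C_m1 g -> 0 < t ->
  mu.-integrable `]0, t[ (EFin \o (fun x => f (t - x) * g x)).
Proof.
move=> Cf Cg t0.
have /C_m1P[p hp [f1 cf1 f1E]] := Cf; have /C_m1P[q hq [g1 cg1 g1E]] := Cg.
have [M M0 HM] := continuous_bounded t cf1.
have [N N0 HN] := continuous_bounded t cg1.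
apply: (@le_integrable _ _ _ mu _ _ _
  (EFin \o (fun x => (M * N) * ((t - x) `^ p * x `^ q)))) => //.
- apply/measurable_EFinP; apply: open_continuous_measurable_fun; first exact: interval_open.
  move=> x /set_mem /=; rewrite in_itv /= => /andP[x0 xt].
  apply: continuousM; last exact: C_m1_continuous.
  apply: (@continuous_comp _ _ _ (fun y : R => t - y) f).
    by apply: continuousB; [exact: cvg_cst|exact: cvg_id].
  by apply: C_m1_continuous => //; rewrite subr_gt0.
- move=> x /=; rewrite in_itv /= => /andP[x0 xt]; rewrite lee_fin.
  rewrite f1E ?subr_gt0// g1E// !normrM.
  rewrite !(ger0_norm (powR_ge0 _ _)) (ger0_norm M0) (ger0_norm N0).
  rewrite mulrACA [leRHS]mulrC ler_wpM2l ?mulr_ge0 ?powR_ge0//.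
  by apply: ler_pM => //; [apply: HM|apply: HN]; apply/andP; split; lra.
- exact: (@integrableZl _ _ _ mu `]0, t[ _ (M * N) _ (integrable_beta hp hq t0)).
Qed.

Section ConvolutionPowers.
Variables (p q : R) (f1 g1 : R -> R).
Hypotheses (hp : -1 < p <= 0) (hq : -1 < q <= 0).
Hypotheses (cf1 : continuous f1) (cg1 : continuous g1).

Let beta (s : R) : R := (1 - s) `^ p * s `^ q.
Let K (t s : R) : R := beta s * (f1 (t * (1 - s)) * g1 (t * s)).

Let K_continuous s : continuous (K ^~ s).
Proof.
move=> t; apply: (@continuousM _ _ (cst (beta s)) _ t); first exact: cvg_cst.
apply: (@continuousM _ _ (fun t => f1 (t * (1 - s))) (fun t => g1 (t * s)) t).
  apply: (@continuous_comp _ _ _ (fun y : R => y * (1 - s)) f1); last exact: cf1.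
  by apply: continuousM; [exact: cvg_id|exact: cvg_cst].
apply: (@continuous_comp _ _ _ (fun y : R => y * s) g1); last exact: cg1.
by apply: continuousM; [exact: cvg_id|exact: cvg_cst].
Qed.

Let K_measurable t : measurable_fun setT (K t).
Proof.
apply: measurable_funM; apply: measurable_funM.
- by apply: measurable_powR_comp; exact: measurable_funB.
- exact: measurable_powR.
- apply: (measurableT_comp (continuous_measurable_fun cf1)).
  by apply: measurable_funM => //; exact: measurable_funB.
- by apply: (measurableT_comp (continuous_measurable_fun cg1)); exact: measurable_funM.
Qed.

Let K_bound (T : R) : exists M : R, forall t s : R, -T < t < T -> 0 < s < 1 ->
  `|K t s| <= M * beta s.
Proof.
have [M M0 HM] := continuous_bounded T cf1.
have [N N0 HN] := continuous_bounded T cg1.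
exists (M * N) => t s /andP[t1 t2] /andP[s0 s1].
rewrite /K normrM ger0_norm ?mulr_ge0 ?powR_ge0// mulrC.
rewrite ler_wpM2r ?mulr_ge0 ?powR_ge0// normrM.
apply: ler_pM => //; [apply: HM|apply: HN]; apply/andP; split; nra.
Qed.

Let beta_integrable : mu.-integrable `]0, 1[ (EFin \o beta).
Proof. exact: integrable_beta. Qed.

Let K_integrable t : mu.-integrable `]0, 1[ (EFin \o K t).
Proof.
have [M HM] := K_bound (`|t| + 1).
apply: (@le_integrable _ _ _ mu _ _ _ (EFin \o (fun x => M * beta x))) => //.
- by apply/measurable_EFinP; apply: measurable_funTS; exact: K_measurable.
- move=> x /=; rewrite in_itv /= => hx; rewrite lee_fin.
  rewrite (le_trans _ (ler_norm _))// HM//.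
  have := ler_norm t; have := ler_norm (- t); rewrite normrN => *.
  by apply/andP; split; lra.
- exact: (@integrableZl _ _ _ mu `]0, 1[ _ M _ beta_integrable).
Qed.

Let W t : R := \int[mu]_(s in `]0, 1[) K t s.

Let W_continuous : continuous W.
Proof.
move=> t; have [M HM] := K_bound (`|t| + 1).
apply: (@continuity_under_integral _ _ _ mu K `]0, 1[ _ (- (`|t| + 1)) (`|t| + 1)
  _ _ (fun x => M * beta x)) => //.
- by apply: aeW => y _ z _; exact: K_continuous.
- exact: (@integrableZl _ _ _ mu `]0, 1[ _ M _ beta_integrable).
- by move=> x /=; rewrite in_itv /= => hx; apply: aeW => y; rewrite in_itv /= => hy; exact: HM.
- apply/mem_set; rewrite /= in_itv /=.
  have := ler_norm t; have := ler_norm (- t); rewrite normrN => *.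
  by apply/andP; split; lra.
Qed.

(** The substitution [tau = t * s] gives
    [(f * g)(t) = t ^ (p + q + 1) * W t], where [W t] is the integral over the
    unit interval of [(1 - s) ^ p * s ^ q * f1 (t * (1 - s)) * g1 (t * s)]. For
    [t] in a bounded interval the integrand is dominated by a multiple of
    the Beta integrand, so [W] is continuous, also at 0. The exact exponent
    is what compares growth rates at the origin in [conv_derive1]. *)
Lemma power_cont_conv f g :
  (forall t : R, 0 < t -> f t = t `^ p * f1 t) ->
  (forall t : R, 0 < t -> g t = t `^ q * g1 t) ->
  power_cont (p + q + 1) (laplace_conv f g).
Proof.
move=> f1E g1E; exists W; first exact: W_continuous.
move=> t t0.
have Cf : C_m1 f by apply/C_m1P; exists p => //; exists f1.
have Cg : C_m1 g by apply/C_m1P; exists q => //; exists g1.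
have pre : (fun x => t * x) @^-1` `]0, t[ = `]0, 1[%classic.
  by apply/seteqP; split => x /=; rewrite !in_itv /= pmulr_rgt0// gtr_pMr.
have phiE (s : R) : 0 < s < 1 -> f (t - t * s) * g (t * s) = t `^ (p + q) * K t s.
  move=> /andP[s0 s1]; rewrite f1E ?g1E; [|by nra|by nra].
  have -> : t - t * s = t * (1 - s) by ring.
  rewrite !powRM ?ltW//; [|by lra].
  rewrite powRD ?(gt_eqF t0) ?implybT// /K /beta; ring.
rewrite /laplace_conv (@Rintegral_dilation R t)//.
- rewrite pre; under eq_Rintegral => s /set_mem /=.
    rewrite in_itv /= => hs; rewrite phiE//; over.
  rewrite RintegralZl//= mulrA /W; congr (_ * _).
  by rewrite [RHS]powRD ?(gt_eqF t0) ?implybT// powRr1 ?ltW// mulrC.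
- by have /integrableP[/measurable_EFinP] := conv_integrable Cf Cg t0.
- rewrite pre; apply: (@eq_integrable _ _ _ mu _ _
    (EFin \o (fun s => t `^ (p + q) * K t s))) => //.
    by move=> s /set_mem /=; rewrite in_itv /= => hs; rewrite phiE.
  exact: (@integrableZl _ _ _ mu `]0, 1[ _ (t `^ (p + q)) _ (K_integrable t)).
Qed.

End ConvolutionPowers.

Lemma C_m1_conv f g : C_m1 f -> C_m1 g -> C_m1 (laplace_conv f g).
Proof.
move=> /C_m1P[p hp [f1 cf1 f1E]] /C_m1P[q hq [g1 cg1 g1E]].
have [W cW WE] := power_cont_conv hp hq cf1 cg1 f1E g1E.
exists (p + q + 1), W; split => //; last exact: continuous_subspaceT.
by move: hp hq => /andP[? _] /andP[? _]; lra.
Qed.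
End Convolution.

(** * Algebra of the Laplace convolution *)

Section ConvolutionAlgebra.
Context {R : realType}.
Local Notation mu := (@lebesgue_measure R).
Implicit Types (t : R) (f g h : R -> R).
Local Notation pos := `]0, +oo[%classic.

Lemma eq_conv f f' g g' t :
  (forall s : R, 0 < s -> f s = f' s) -> (forall s : R, 0 < s -> g s = g' s) ->
  laplace_conv f g t = laplace_conv f' g' t.
Proof.
move=> ff' gg'; apply: eq_Rintegral => x /set_mem /=; rewrite in_itv /= => /andP[x0 xt].
by rewrite ff' ?subr_gt0// gg'.
Qed.

Lemma conv_le0 f g t : t <= 0 -> laplace_conv f g t = 0.
Proof.
by move=> t0; rewrite /laplace_conv set_itv_ge ?Rintegral_set0// bnd_simp -leNgt.
Qed.

Lemma conv_restrict f g : laplace_conv f g \_ pos = laplace_conv f g.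
Proof.
apply/funext => t; rewrite patchE; case: ifPn => // /negP ht.
rewrite conv_le0// leNgt; apply/negP => t0; apply: ht.
by apply/mem_set; rewrite /= in_itv /= t0.
Qed.

Lemma restrict_mul f g t :
  (fun x : R => f (t - x) * g x) \_ `]0, t[ =
  (fun x : R => (f \_ pos) (t - x) * (g \_ pos) x).
Proof.
apply/funext => x; rewrite !patchE !mem_setE !in_itv /= !andbT subr_gt0.
by case: (ltP 0 x); case: (ltP x t) => /= *; rewrite ?mul0r ?mulr0.
Qed.

(** With both factors extended by 0, the convolution is an integral over
    the whole line, where the changes of variables and Fubini's theorem
    need no bookkeeping of the domain. *)
Lemma conv_full f g t :
  laplace_conv f g t = \int[mu]_x ((f \_ pos) (t - x) * (g \_ pos) x).
Proof. by rewrite -restrict_mul -Rintegral_mkcond. Qed.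

Lemma conv_full_integrable f g t : C_m1 f -> C_m1 g ->
  mu.-integrable setT (EFin \o (fun x => (f \_ pos) (t - x) * (g \_ pos) x)).
Proof.
move=> Cf Cg; rewrite -restrict_mul -restrict_EFin.
apply: (iffLR (integrable_mkcond _ _)) => //.
have [t0|t0] := ltP 0 t; first exact: conv_integrable.
by rewrite set_itv_ge ?bnd_simp -?leNgt//; exact: integrable_set0.
Qed.

Lemma convC f g t : C_m1 f -> C_m1 g -> laplace_conv f g t = laplace_conv g f t.
Proof.
move=> Cf Cg; rewrite !conv_full (@Rintegral_reflect R t)//.
- rewrite preimage_setT; apply: eq_Rintegral => x _.
  by rewrite subKr mulrC.
- apply: measurable_funM; last exact: C_m1_measurable.
  by apply: (measurableT_comp (C_m1_measurable Cf)); exact: measurable_funB.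
- rewrite preimage_setT.
  apply: (@eq_integrable _ _ _ mu _ _
    (EFin \o (fun x => (g \_ pos) (t - x) * (f \_ pos) x))) => //.
    by move=> x _ /=; rewrite subKr mulrC.
  exact: conv_full_integrable.
Qed.

Lemma convDr f g h t : C_m1 f -> C_m1 g -> C_m1 h ->
  laplace_conv f (fun x => g x + h x) t = laplace_conv f g t + laplace_conv f h t.
Proof.
move=> Cf Cg Ch; have [t0|t0] := ltP 0 t; last by rewrite !conv_le0// addr0.
rewrite /laplace_conv -RintegralD//; try exact: conv_integrable.
by apply: eq_Rintegral => x _; rewrite mulrDr.
Qed.

Lemma convZr f g (c : R) t : C_m1 f -> C_m1 g ->
  laplace_conv f (fun x => c * g x) t = c * laplace_conv f g t.
Proof.
move=> Cf Cg; have [t0|t0] := ltP 0 t; last by rewrite !conv_le0// mulr0.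
rewrite /laplace_conv -RintegralZl//; last exact: conv_integrable.
by apply: eq_Rintegral => x _; rewrite mulrCA.
Qed.

Lemma conv_sumr f n (a : 'I_n -> R) (b : 'I_n -> R -> R) t :
  C_m1 f -> (forall i, C_m1 (b i)) ->
  laplace_conv f (fun x => \sum_(i < n) a i * b i x) t =
  \sum_(i < n) a i * laplace_conv f (b i) t.
Proof.
move=> Cf; elim: n a b => [|n IH] a b Cb.
  rewrite big_ord0 (@eq_conv f f _ (fun x => 0 * cst 0 x))//.
    by rewrite convZr ?mul0r//; exact: C_m1_cst.
  by move=> s _; rewrite big_ord0 mul0r.
rewrite big_ord_recr /= -IH// -convZr// -convDr//.
- by apply: eq_conv => // s _; rewrite big_ord_recr.
- exact: C_m1_sum.
- exact: C_m1Z.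
Qed.

(** The integrand of the triple convolution on the plane, with [z.1] the
    outer and [z.2] the inner variable. *)
Let Phi f g h t (z : measurableTypeR R * measurableTypeR R) : R :=
  (f \_ pos) (t - z.1 - z.2) * (g \_ pos) z.2 * (h \_ pos) z.1.

Let Phi_measurable f g h t : C_m1 f -> C_m1 g -> C_m1 h ->
  measurable_fun setT (Phi f g h t).
Proof.
move=> Cf Cg Ch; apply: measurable_funM; first apply: measurable_funM.
- apply: (measurableT_comp (C_m1_measurable Cf)).
  by apply: measurable_funB => //; exact: measurable_funB.
- exact: (measurableT_comp (C_m1_measurable Cg)).
- exact: (measurableT_comp (C_m1_measurable Ch)).
Qed.

Let Phi_inner f g h t (x : R) : C_m1 f -> C_m1 g ->
  (\int[mu]_y (Phi f g h t (x, y))%:E =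
   ((laplace_conv f g \_ pos) (t - x) * (h \_ pos) x)%:E)%E.
Proof.
move=> Cf Cg; rewrite conv_restrict conv_full -RintegralZr//; last first.
  exact: conv_full_integrable.
rewrite /Rintegral fineK//; apply: integrable_fin_num => //.
apply: (@eq_integrable _ _ _ mu _ _ (EFin \o (fun y =>
    (h \_ pos) x * ((f \_ pos) (t - x - y) * (g \_ pos) y)))) => //.
  by move=> y _ /=; rewrite mulrC.
exact: (@integrableZl _ _ _ mu setT _ ((h \_ pos) x) _
  (conv_full_integrable (t - x) Cf Cg)).
Qed.

(** The integral of the absolute value is itself a triple convolution, that of
    the absolute values, which is finite because they stay in [C_m1]. *)
Let Phi_integrable f g h t : C_m1 f -> C_m1 g -> C_m1 h ->
  (mu \x mu)%E.-integrable setT (EFin \o Phi f g h t).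
Proof.
move=> Cf Cg Ch; apply/integrable12ltyP.
  by apply/measurable_EFinP; exact: Phi_measurable.
pose af x := `|f x|; pose ag x := `|g x|; pose ah x := `|h x|.
have [Caf Cag Cah] : [/\ C_m1 af, C_m1 ag & C_m1 ah] by split; exact: C_m1_norm.
have E (x y : R) : `|Phi f g h t (x, y)| = Phi af ag ah t (x, y).
  by rewrite /Phi !normrM !patchE /=; do !case: ifP; rewrite ?normr0.
under eq_integral => x _.
  under eq_integral => y _ do rewrite /= E.
  rewrite Phi_inner//; over.
have := conv_full_integrable t (C_m1_conv Caf Cag) Cah.
move=> /integrableP[_]; apply: le_lt_trans.
rewrite le_eqVlt; apply/orP; left; apply/eqP; apply: eq_integral => x _ /=.
rewrite ger0_norm// conv_restrict; apply: mulr_ge0.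
  by apply: Rintegral_ge0 => y _; apply: mulr_ge0; exact: normr_ge0.
by rewrite patchE; case: ifP => _ //; exact: normr_ge0.
Qed.

(** Associativity in disguise. In this form the triple integrand is symmetric
    under exchanging the last two functions together with the two variables, so
    Fubini's theorem applies without translating the inner variable. *)
Lemma conv_swap f g h t : C_m1 f -> C_m1 g -> C_m1 h ->
  laplace_conv (laplace_conv f g) h t = laplace_conv (laplace_conv f h) g t.
Proof.
move=> Cf Cg Ch; rewrite !conv_full /Rintegral; congr fine.
under eq_integral => x _ do rewrite -Phi_inner//.
rewrite (Fubini (Phi_integrable t Cf Cg Ch)).
apply: eq_integral => x _; rewrite -Phi_inner//.
by apply: eq_integral => y _; rewrite /Phi /= mulrAC (addrAC t).
Qed.

End ConvolutionAlgebra.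

(** * Calculus on the positive half-line *)

Section HalfLineCalculus.
Context {R : realType}.
Local Notation mu := (@lebesgue_measure R).
Implicit Types (t : R) (f g u : R -> R) (n : nat).

Lemma near_eq_pos f g t : (forall s : R, 0 < s -> f s = g s) -> 0 < t ->
  \forall s \near t, f s = g s.
Proof. by move=> fg t0; near=> s; apply: fg; near: s; exact: lt_nbhsr.
Unshelve. end_near. Qed.

Lemma derivable_eq_pos f g t : (forall s : R, 0 < s -> f s = g s) -> 0 < t ->
  derivable f t 1 -> derivable g t 1.
Proof. by move=> fg t0; apply: near_eq_derivable => //; exact: near_eq_pos. Qed.

Lemma derive1_eq_pos f g t : (forall s : R, 0 < s -> f s = g s) -> 0 < t ->
  derive1 f t = derive1 g t.
Proof.
move=> fg t0; rewrite !derive1E; apply: near_eq_derive => //.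
exact: near_eq_pos.
Qed.

Lemma derive1nSr n f : derive1n n.+1 f = derive1n n (derive1 f).
Proof. by rewrite /derive1n iterSr. Qed.

Lemma nderivable_posS n f : nderivable_pos n.+1 f <->
  (forall t, 0 < t -> derivable f t 1) /\ nderivable_pos n (derive1 f).
Proof.
split=> [H|[H0 H] [|i] hi t t0]; last 2 first.
- exact: H0.
- by rewrite derive1nSr; exact: H.
split=> [t t0|i hi t t0]; first exact: (H 0%N).
by rewrite -derive1nSr; exact: H.
Qed.

Lemma derive1_pos0_cst f : (forall t, 0 < t -> derivable f t 1) ->
  (forall t, 0 < t -> derive1 f t = 0) -> forall t, 0 < t -> f t = f 1.
Proof.
move=> df f0.
suff H (s t : R) : 0 < s -> s < t -> f s = f t.
  move=> t t0; have [h|h|->//] := ltgtP t 1; first exact: H.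
  by apply/esym/H => //; lra.
move=> s0 st; have fx (x : R) : 0 < x -> is_derive x 1 f 0.
  by move=> x0; apply: DeriveDef; [exact: df|rewrite -derive1E f0].
have [||c _ /eqP] := @MVT R f (cst 0) s t st.
- by move=> x; rewrite in_itv /= => /andP[sx _]; apply: fx; exact: lt_trans sx.
- apply: continuous_in_subspaceT => x /set_mem /=; rewrite in_itv /= => /andP[sx _].
  by apply/differentiable_continuous/derivable1_diffP/df; exact: lt_le_trans sx.
- by rewrite mul0r subr_eq0 => /eqP.
Qed.

Lemma derive1_pos_eq_cst f g :
  (forall t, 0 < t -> derivable f t 1) -> (forall t, 0 < t -> derivable g t 1) ->
  (forall t, 0 < t -> derive1 f t = derive1 g t) ->
  exists c, forall t, 0 < t -> f t = c + g t.
Proof.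
move=> df dg fg; exists (f 1 - g 1) => t t0.
apply/eqP; rewrite -subr_eq; apply/eqP.
suff : (f - g) t = (f - g) 1 by [].
apply: derive1_pos0_cst t t0 => s s0.
  by apply: derivableB; [exact: df|exact: dg].
rewrite derive1E deriveB; [|exact: df|exact: dg].
by rewrite -!derive1E fg// subrr.
Qed.

Lemma conv1E f t : laplace_conv (cst 1) f t = \int[mu]_(x in `]0, t[) f x.
Proof. by apply: eq_Rintegral => x _; rewrite mul1r. Qed.

Lemma conv1_derive f t : C_m1 f -> 0 < t ->
  derivable (laplace_conv (cst 1) f) t 1 /\ derive1 (laplace_conv (cst 1) f) t = f t.
Proof.
move=> Cf t0.
have fi (u : R) : 0 < u -> mu.-integrable `]0, u] (EFin \o f).
  move=> u0; apply: (@integrableS _ _ _ mu `]0, (u + 1)[) => //.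
    by apply: subset_itvl; rewrite bnd_simp; lra.
  by apply: C_m1_integrable => //; lra.
have tt1 : t < t + 1 by lra.
have t10 : 0 < t + 1 by lra.
have [|d1 d2] := @continuous_FTC1 R f (BRight 0) t (t + 1)
  tt1 (fi _ t10) _ (C_m1_continuous Cf t0).
  by rewrite lte_fin.
have E (s : R) : 0 < s -> \int[mu]_(x in `]0, s]) f x = laplace_conv (cst 1) f s.
  by move=> s0; rewrite conv1E Rintegral_itv_bndo_bndc//; exact: C_m1_integrable.
by split; [exact: derivable_eq_pos E t0 d1|rewrite -(derive1_eq_pos E t0)].
Qed.

(** Convolving with the constant 1 is integration from 0, undone by
    differentiating. *)
Lemma conv1_inj f g : C_m1 f -> C_m1 g ->
  (forall t, 0 < t -> laplace_conv (cst 1) f t = laplace_conv (cst 1) g t) ->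
  forall t, 0 < t -> f t = g t.
Proof.
move=> Cf Cg E t t0.
by rewrite -(conv1_derive Cf t0).2 -(conv1_derive Cg t0).2; exact: derive1_eq_pos.
Qed.

(** The constant is the value of [u] at the origin: a function with derivative
    in [C_m1] extends continuously there. *)
Lemma primitive_conv1 u : (forall t, 0 < t -> derivable u t 1) -> C_m1 (derive1 u) ->
  exists c, forall t, 0 < t -> u t = c + laplace_conv (cst 1) (derive1 u) t.
Proof.
move=> du Cu; apply: derive1_pos_eq_cst => //.
  by move=> t t0; have [] := conv1_derive Cu t0.
by move=> t t0; have [_ ->] := conv1_derive Cu t0.
Qed.

Lemma C_m1_primitive u : (forall t, 0 < t -> derivable u t 1) ->
  C_m1 (derive1 u) -> C_m1 u.
Proof.
move=> du Cu; have [c E] := primitive_conv1 du Cu.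
apply: (@C_m1_eq _ (fun t => c + laplace_conv (cst 1) (derive1 u) t)).
  by move=> t t0; rewrite E.
by apply: C_m1D; [exact: C_m1_cst|apply: C_m1_conv => //; exact: C_m1_cst].
Qed.

(** The lower derivatives are successive primitives of the last one. *)
Lemma C_m1_derive1n m f : nderivable_pos m f -> C_m1 (derive1n m f) ->
  forall j, (j <= m)%N -> C_m1 (derive1n j f).
Proof.
elim: m f => [|m IH] f; first by move=> _ Cf [|].
move=> /nderivable_posS[df dm]; rewrite derive1nSr => Cm.
have H := IH _ dm Cm.
move=> [|j] hj; last by rewrite derive1nSr; exact: H.
by apply: C_m1_primitive => //; exact: (H 0%N).
Qed.

Lemma h_fun1 t : h_fun 1 t = 1.
Proof. by rewrite /h_fun /= expr0 fact0 divr1. Qed.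

Lemma h_fun_derive n t :
  derivable (h_fun n.+2) t 1 /\ derive1 (h_fun n.+2) t = h_fun n.+1 t.
Proof.
have hE : h_fun n.+2 = (n.+1`!%:R)^-1 *: (id ^+ n.+1) :> (R -> R).
  apply/funext => x; rewrite /h_fun /= mulrC.
  by rewrite exprfctE.
have H : is_derive t 1 (h_fun n.+2) (h_fun n.+1 t).
  rewrite hE; apply: is_derive_eq.
  rewrite /h_fun /GRing.scale /= mulr1 factS natrM.
  have n1 : n.+1%:R != 0 :> R by rewrite pnatr_eq0.
  have nf : n`!%:R != 0 :> R by rewrite pnatr_eq0 -lt0n fact_gt0.
  by rewrite invfM mulrACA mulVf// mul1r mulrC.
by split; [exact: ex_derive|rewrite derive1E derive_val].
Qed.

(** Differentiation shifts the index of [h_fun] down by one and kills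
    [h_fun 1], which is constant. *)
Lemma sum_h_fun_derive n (a : 'I_n.+1 -> R) t :
  derivable (fun s => \sum_(i < n.+1) a i * h_fun i.+1 s) t 1 /\
  derive1 (fun s => \sum_(i < n.+1) a i * h_fun i.+1 s) t =
  \sum_(i < n) a (lift ord0 i) * h_fun i.+1 t.
Proof.
have E : (fun s => \sum_(i < n.+1) a i * h_fun i.+1 s) =
    cst (a ord0) + \sum_(i < n) (a (lift ord0 i) *: h_fun i.+2) :> (R -> R).
  apply/funext => s; rewrite big_ord_recl h_fun1 mulr1.
  by rewrite [in RHS]fctE fct_sumE.
have H : is_derive t 1 (fun s => \sum_(i < n.+1) a i * h_fun i.+1 s)
    (0 + \sum_(i < n) (a (lift ord0 i) *: h_fun i.+1 t)).
  rewrite E; apply: is_deriveD; apply: is_derive_sum => i.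
  apply: is_deriveZ; have [d1 d2] := h_fun_derive i t.
  by apply: DeriveDef => //; rewrite -derive1E.
by split; [exact: ex_derive|rewrite derive1E derive_val add0r].
Qed.

Lemma derive1n_pos0P n u :
  (nderivable_pos n u /\ forall t, 0 < t -> derive1n n u t = 0) <->
  exists a : 'I_n -> R, forall t, 0 < t -> u t = \sum_(i < n) a i * h_fun i.+1 t.
Proof.
elim: n u => [|n IH] u.
  split=> [[_ u0]|[a aE]]; last first.
    by split => [[]//|t t0]; have := aE t t0; rewrite big_ord0.
  by exists (fun=> 0) => t t0; rewrite big_ord0; exact: u0.
split=> [[/nderivable_posS[du dn] un]|[a aE]].
  have [a aE] : exists a : 'I_n -> R, forall t, 0 < t ->
      derive1 u t = \sum_(i < n) a i * h_fun i.+1 t.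
    by apply/IH; split => // t t0; rewrite -derive1nSr; exact: un.
  (* the coefficients a shifted up by one, with integration constant c in front *)
  pose b0 (c : R) (i : 'I_n.+1) := if unlift ord0 i is Some j then a j else c.
  have [||c cE] := @derive1_pos_eq_cst u
      (fun s => \sum_(i < n.+1) b0 0 i * h_fun i.+1 s) du.
  - by move=> t _; have [] := sum_h_fun_derive (b0 0) t.
  - move=> t t0; have [_ ->] := sum_h_fun_derive (b0 0) t; rewrite aE//.
    by apply: eq_bigr => i _; rewrite /b0 liftK.
  exists (b0 c) => t t0; rewrite cE// !big_ord_recl /b0 unlift_none mul0r add0r.
  by rewrite h_fun1 mulr1; congr (_ + _); apply: eq_bigr => i _; rewrite liftK.
have E := fun s s0 => esym (aE s s0).
have [H1 H2] : nderivable_pos n (derive1 u) /\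
    forall t, 0 < t -> derive1n n (derive1 u) t = 0.
  apply/IH; exists (fun i => a (lift ord0 i)) => t t0.
  by rewrite -(derive1_eq_pos E t0); have [] := sum_h_fun_derive a t.
split; last by move=> t t0; rewrite derive1nSr; exact: H2.
apply/nderivable_posS; split => // t t0.
by apply: (derivable_eq_pos E t0); have [] := sum_h_fun_derive a t.
Qed.

Lemma h_fun_free n (a : 'I_n -> R) :
  (forall t, 0 < t -> \sum_(i < n) a i * h_fun i.+1 t = 0) -> forall i, a i = 0.
Proof.
elim: n a => [|n IH] a H; first by case.
have a0 i : a (lift ord0 i) = 0.
  apply: (IH (fun i => a (lift ord0 i))) => t t0.
  have [_ <-] := sum_h_fun_derive a t.
  by rewrite (derive1_eq_pos H t0) derive1_cst.
move=> i; case: (unliftP ord0 i) => [j ->|->]; first exact: a0.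
have := H 1 ltr01; rewrite big_ord_recl h_fun1 mulr1 big1 ?addr0// => j _.
by rewrite a0 mul0r.
Qed.

End HalfLineCalculus.

(** * The null space of the fractional derivative *)

Section NullSpace.
Context {R : realType}.
Implicit Types (p t : R) (f g k : R -> R).

(** After division by [t ^ p], the two sides tend to [c * k1 0]
    and to 0 as [t] tends to 0. *)
Lemma singular_coef0 p r k1 k f (c : R) : p < r -> cont_nneg k1 -> k1 0 != 0 ->
  (forall t, 0 < t -> k t = t `^ p * k1 t) -> power_cont r f ->
  (forall t, 0 < t -> c * k t = f t) -> c = 0.
Proof.
move=> pr ck1 k10 kE [f1 cf1 f1E] ckf.
have ckm := cont_nneg_extend ck1.
have rp0 : 0 < r - p by rewrite subr_gt0.
have cpm := cont_nneg_extend (cont_nneg_powR rp0).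
have L1 : (c * k1 (Num.max t 0)) @[t --> (0 : R)^'+] --> c * k1 0.
  apply: cvg_at_right_filter; rewrite -[in X in _ --> X](maxxx (0 : R)).
  by apply: cvgM; [exact: cvg_cst|exact: ckm].
have L2 : ((Num.max t 0) `^ (r - p) * f1 t) @[t --> (0 : R)^'+] -->
    (Num.max (0 : R) 0) `^ (r - p) * f1 0.
  by apply: cvg_at_right_filter; apply: cvgM; [exact: cpm|exact: cf1].
rewrite maxxx powR0 ?gt_eqF// mul0r in L2.
have E : \forall t \near (0 : R)^'+,
    c * k1 (Num.max t 0) = (Num.max t 0) `^ (r - p) * f1 t.
  near=> t; have t0 : 0 < t by [].
  rewrite !max_l ?ltW//; apply: (@mulfI _ (t `^ p)); first by rewrite gt_eqF ?powR_gt0.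
  rewrite mulrCA -kE// ckf// f1E// mulrA -powRD ?(gt_eqF t0) ?implybT//.
  by rewrite addrC subrK.
have L3 := cvg_trans (near_eq_cvg E) L1.
have : c * k1 0 = 0.
  by rewrite -(cvg_lim (@Rhausdorff R) (L3 _)) (cvg_lim (@Rhausdorff R) L2).
by move=> /eqP; rewrite mulf_eq0 (negbTE k10) orbF => /eqP.
Unshelve. all: end_near. Qed.

Lemma power_cont_h_fun n : power_cont 0 (@h_fun R n).
Proof.
exists (h_fun n) => [t|t t0]; last by rewrite powRr0 mul1r.
apply: (@continuousM _ _ (fun t => t ^+ n.-1) (cst _) t).
  exact: exprn_continuous.
exact: cvg_cst.
Qed.

(** Two uses of commutativity turn [conv_swap] into associativity. *)
Lemma C_m1_convA f g h t : C_m1 f -> C_m1 g -> C_m1 h ->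
  laplace_conv (laplace_conv f g) h t = laplace_conv f (laplace_conv g h) t.
Proof.
move=> Cf Cg Ch.
rewrite (@eq_conv _ _ (laplace_conv g f) h h)//; last by move=> s _; exact: convC.
by rewrite conv_swap// convC//; exact: C_m1_conv.
Qed.

(** Write [g = c + 1 * g'] with [c = g(0+)]. Then
    [g * k = 1 * (c k + g' * k)], and differentiating gives
    [h_(m+1) = c k + g' * k]. Here [h_(m+1)] is bounded near 0 and [g' * k] is of
    order [t ^ (p + q + 1)] with [q > -1], whereas [k] blows up like [t ^ p]; so
    [c = 0]. *)
Lemma conv_derive1 k g m : C_m1 k -> singular_at0 k ->
  (forall t, 0 < t -> derivable g t 1) -> C_m1 (derive1 g) ->
  (forall t, 0 < t -> laplace_conv g k t = h_fun m.+2 t) ->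
  forall t, 0 < t -> laplace_conv (derive1 g) k t = h_fun m.+1 t.
Proof.
move=> Ck [p [k1 [/andP[p1 p0] ck1 k10 kE]]] dg Cg' gk.
have C1 : C_m1 (cst (1 : R)) by exact: C_m1_cst.
have Cg'k := C_m1_conv Cg' Ck.
have [c gE] := primitive_conv1 dg Cg'.
have E t : 0 < t -> h_fun m.+1 t = c * k t + laplace_conv (derive1 g) k t.
  move=> t0; have [_ <-] := h_fun_derive m t.
  have [_ <-] := conv1_derive (C_m1D (C_m1Z c Ck) Cg'k) t0.
  apply: derive1_eq_pos => // s s0; rewrite -gk//.
  rewrite convDr//; last exact: C_m1Z.
  rewrite convZr// -C_m1_convA//.
  rewrite (convC _ C1 Ck) (convC _ (C_m1_conv C1 Cg') Ck) -convZr// -convDr//.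
  - rewrite convC//; last exact: C_m1_primitive.
    by apply: eq_conv => // r r0; rewrite gE// mulr1.
  - exact: C_m1Z.
  - exact: C_m1_conv.
suff c0 : c = 0 by move=> t t0; rewrite E// c0 mul0r add0r.
have /C_m1P[q /andP[q1 q0] [g1 cg1 g1E]] := Cg'.
have k1E t : 0 < t -> k t = t `^ p * k1 (Num.max t 0).
  by move=> t0; rewrite kE// max_l ?ltW.
have hq : -1 < q <= 0 by rewrite q1.
have hp : -1 < p <= 0 by rewrite p1 ltW.
have pg := power_cont_conv hq hp cg1 (cont_nneg_extend ck1) g1E k1E.
(* The minimum is a common exponent of h_(m+1) and g' * k, still above p. *)
apply: (@singular_coef0 p (Num.min 0 (q + p + 1)) k1 k
  (fun t => h_fun m.+1 t + -1 * laplace_conv (derive1 g) k t)) => //.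
- by rewrite lt_min p0; lra.
- apply: power_contD.
    by apply: power_cont_weaken (power_cont_h_fun m.+1); rewrite ge_min lexx.
  by apply/power_contZ/(power_cont_weaken _ pg); rewrite ge_min lexx orbT.
- by move=> t t0; rewrite E// mulN1r addrK.
Qed.

Lemma conv_derive1n k kappa m : C_m1 k -> singular_at0 k -> Cn_m1 m kappa ->
  (forall t, 0 < t -> laplace_conv kappa k t = h_fun m.+1 t) ->
  forall j, (j <= m)%N -> forall t, 0 < t ->
    laplace_conv (derive1n j kappa) k t = h_fun (m - j).+1 t.
Proof.
move=> Ck sk [_ dk Cm] H; elim=> [|j IH] jm t t0; first by rewrite subn0 H.
rewrite derive1nS; apply: conv_derive1 => //.
- by move=> s s0; exact: dk.
- by rewrite -derive1nS; exact: C_m1_derive1n Cm _ jm.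
- by move=> s s0; rewrite subnSK//; apply: IH => //; exact: ltnW.
Qed.

End NullSpace.

Theorem theorem2p2 (R : realType) (n : nat) (kappa k : R -> R) :
  (0 < n)%N ->
  L_class n (kappa, k) ->
  singular_at0 k ->
  Cn_m1 n.-1 kappa ->
  GFD_ker n k = span_pos (fun i : 'I_n => derive1n (n.-1 - i)%N kappa) /\
  has_dim_pos (GFD_ker n k) n.
Proof.
case: n => [//|m] _ /= [_ /= [p [k1 [/andP[p1 _] ck1 k1E]]] convE] sk Ckappa.
have Ck : C_m1 k by exists p, k1.
pose b (i : 'I_m.+1) := derive1n (m - i)%N kappa.
have Cb i : C_m1 (b i).
  by have [_ dk Cm] := Ckappa; apply: C_m1_derive1n dk Cm _ _; exact: leq_subr.
have kb i (t : R) : 0 < t -> laplace_conv k (b i) t = h_fun i.+1 t.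
  move=> t0; rewrite convC// (conv_derive1n Ck sk Ckappa convE) ?leq_subr//.
  by rewrite subKn// -ltnS.
have kspan (a : 'I_m.+1 -> R) (t : R) : 0 < t ->
    laplace_conv k (fun s => \sum_(i < m.+1) a i * b i s) t =
    \sum_(i < m.+1) a i * h_fun i.+1 t.
  by move=> t0; rewrite conv_sumr//; apply: eq_bigr => i _; rewrite kb.
(* The derivative of order m of kappa, which is b ord0, inverts k up to integration. *)
have k_inj f g : C_m1 f -> C_m1 g ->
    (forall t : R, 0 < t -> laplace_conv k f t = laplace_conv k g t) ->
    forall t : R, 0 < t -> f t = g t.
  move=> Cf Cg fg; apply: conv1_inj => // t t0.
  have E h : C_m1 h ->
      laplace_conv (cst 1) h t = laplace_conv (laplace_conv k h) (b ord0) t.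
    move=> Ch; rewrite conv_swap//; apply: eq_conv => // s s0.
    by rewrite kb// h_fun1.
  by rewrite (E f Cf) (E g Cg); apply: eq_conv.
have kerE : GFD_ker m.+1 k = span_pos b.
  apply/seteqP; split => f.
    move=> [[Cf df _] f0].
    have [a aE] := (derive1n_pos0P m.+1 (laplace_conv k f)).1 (conj df f0).
    exists a => t t0; apply: (k_inj f (fun s => \sum_(i < m.+1) a i * b i s)) => //.
      exact: C_m1_sum.
    by move=> s s0; rewrite aE// kspan.
  move=> [a fE].
  have Cf : C_m1 f by apply: C_m1_eq (C_m1_sum a Cb) => t t0; rewrite fE.
  have [df f0] : nderivable_pos m.+1 (laplace_conv k f) /\
      forall t : R, 0 < t -> derive1n m.+1 (laplace_conv k f) t = 0.
    apply/derive1n_pos0P; exists a => t t0; rewrite -kspan//; exact: eq_conv.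
  split=> //; split=> //.
  by apply: C_m1_eq (C_m1_cst 0) => t t0; rewrite /GFD f0.
(* Convolved with k, a relation between the b i is one between the h's. *)
split=> //; exists b; split=> // a a0; apply: h_fun_free => t t0.
rewrite -kspan// (@eq_conv _ k k _ (fun s => 0 * cst 0 s))//.
  by rewrite convZr ?mul0r//; exact: C_m1_cst.
by move=> s s0; rewrite a0// mul0r.
Qed.
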